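(* Let $b \ge 2$ be an integer and $\xi$ an irrational real number. If $\mu$ denotes the irrationality exponent of $\xi$, then $$ \liminf_{n \to + \infty} \, \frac{p(n, \xi, b)}{n} \ge 1+ \frac{-\mu^3 + 2 \mu^2 + \mu - 1}{\mu^4 - 2 \mu^3 + 3 \mu^2 - 3 \mu + 1} $$ and $$ \limsup_{n \to + \infty} \, \frac{p(n, \xi, b)}{n} \ge \frac{\mu + \sqrt{ 4(\mu - 1)^3 + \mu^2 } }{2 \mu (\mu - 1)}. $$ In particular, every irrational real number $\xi$ whose irrationality exponent is equal to $2$ satisfies $$ \liminf_{n \to + \infty} \, \frac{p(n, \xi, b)}{n} \ge \frac{8}{7} \quad \text{and} \quad \limsup_{n \to + \infty} \, \frac{p(n, \xi, b)}{n} \ge \frac{1 + \sqrt{2}}{2}. $$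
   Context: The irrationality exponent $\mu(\xi)$ of an irrational real number $\xi$ is the supremum of the real numbers $\mu$ such that the inequality $\left| \xi - \frac{p}{q} \right| < \frac{1}{q^{\mu}}$ has infinitely many solutions in rational numbers $p/q$ (with $q \ge 1$). One always has $2 \le \mu(\xi) \le +\infty$; if $\mu(\xi) = +\infty$, the right-hand sides of the two inequalities are read as their limits as $\mu \to +\infty$, namely $1$ and $0$. For an integer $b \ge 2$, the $b$-ary expansion of a real number $\xi$ is the unique infinite sequence $(a_j)_{j \ge 1}$ of integers from $\{0, 1, \ldots, b-1\}$ such that $\xi = \lfloor \xi \rfloor + \sum_{j\ge 1} \frac{a_j}{b^j}$ and $a_j \ne b-1$ for infinitely many indices $j$, where $\lfloor \cdot \rfloor$ is the integer part function. For an infinite word $\mathbf{x} = x_1 x_2 \ldots$ over a finite alphabet, its subword complexity function is $$p(n,\mathbf{x}) = \mathrm{Card} \{ x_{j+1} x_{j+2} \dots x_{j+n} : j \ge 0 \}, \quad n \ge 1,$$ the number of different subwords (blocks of consecutive letters) of length $n$ occurring in $\mathbf{x}$. One sets $p(n, \xi, b) = p(n, \mathbf{a})$ for $n \ge 1$, where $\mathbf{a} = a_1 a_2 \ldots$ is the infinite word formed by the $b$-ary expansion of $\xi$. *)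

(* Defs.v *)
From HB Require Import structures.
From mathcomp Require Import all_boot all_order all_algebra.
From mathcomp Require Import all_classical all_reals all_analysis.
From mathcomp Require Import ring lra zify.
Set Implicit Arguments.
Unset Strict Implicit.
Unset Printing Implicit Defensive.
Import Order.TTheory GRing.Theory Num.Theory.
Import numFieldNormedType.Exports.
Local Open Scope classical_set_scope.
Local Open Scope ring_scope.

(* Solutions are counted as rational numbers, with q the denominator of the
   reduced form.  For m > 0 the reduced form gives the weakest inequality among
   all representations p/q, and for m <= 0 there are always infinitely many
   solutions. *)
Definition irrationality_exponent (R : realType) (xi : R) : \bar R :=
  ereal_sup [set m%:E | m in [set m : R |
    infinite_set [set r : rat |
      `|xi - ratr r| < 1 / ((denq r)%:~R `^ m)]]].

(* Words are indexed from 0: [x i] is the letter x_(i+1). *)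
Definition subword_complexity (A : finType) (x : nat -> A) (n : nat) : nat :=
  #|[set w : n.-tuple A | `[< exists j : nat, w = [tuple x (j + i)%N | i < n] >]]%SET|.

Definition is_bary_expansion (R : realType) (b : nat) (xi : R)
    (a : nat -> 'I_b) : Prop :=
  (series (fun j => (a j)%:R / b%:R ^+ j.+1) @ \oo --> xi - (Num.floor xi)%:~R)
  /\ infinite_set [set j | a j != b.-1 :> nat].

Lemma finite_nat_bounded (S : set nat) :
  finite_set S -> exists N, forall j, (N <= j)%N -> ~ S j.
Proof.
move=> /finite_seqP [s ->]; exists (\max_(i <- s) i).+1 => j hj /= js.
by have := @leq_bigmax_seq _ s xpredT id j js isT; rewrite leqNgt hj.
Qed.

Section expansion_unique.
Context (R : realType) (b : nat) (hb : (1 < b)%N) (xi : R).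

Let B : R := b%:R.
Let B0 : 0 < B. Proof. by rewrite ltr0n (ltn_trans _ hb). Qed.
Let B2 : 2 <= B. Proof. by rewrite ler_nat. Qed.

Let F n : int := Num.floor (B ^+ n * xi).
Let t n : R := B ^+ n * xi - (F n)%:~R.

Let t_ge0 n : 0 <= t n.
Proof. by rewrite subr_ge0 floor_le. Qed.

Let t_lt1 n : t n < 1.
Proof.
by have /andP[_] := floor_itv (B ^+ n * xi); rewrite intrD ltrBlDl.
Qed.

Let d n : int := F n.+1 - F n * b%:Z.

Let dE n : (d n)%:~R = B * t n - t n.+1.
Proof. by rewrite /d /t rmorphB rmorphM /= exprS; rewrite /B; ring. Qed.

Let d_bounds n : (0 <= d n) && (d n < b%:Z).
Proof.
have h1 := t_ge0 n; have h2 := t_lt1 n.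
have h3 := t_ge0 n.+1; have h4 := t_lt1 n.+1.
have H0 : 0 <= B * t n by rewrite mulr_ge0 // ltW.
have H1 : B * t n < B by rewrite -[ltRHS]mulr1 ltr_pM2l.
apply/andP; split.
  have : (-1)%:~R < (d n)%:~R :> R by rewrite dE; lra.
  by rewrite ltr_int.
by rewrite -(ltr_int R) dE; rewrite -/B; lra.
Qed.

Let dn_lt n : (`|d n|%N < b)%N.
Proof. by have /andP[h0 h1] := d_bounds n; rewrite -ltz_nat gez0_abs. Qed.

Let a n : 'I_b := Ordinal (dn_lt n).

Let aE n : (a n)%:R = B * t n - t n.+1.
Proof.
have /andP[h0 h1] := d_bounds n.
by rewrite -dE /= -[in RHS](gez0_abs h0).
Qed.

Let partial n :
  series (fun j => (a j)%:R / B ^+ j.+1) n = t 0 - t n / B ^+ n.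
Proof.
elim: n => [|n IH]; first by rewrite /series /= big_geq // expr0 divr1 subrr.
rewrite seriesSr IH aE exprS.
have hn : B ^+ n != 0 by rewrite expf_neq0 // gt_eqF.
by field; rewrite hn gt_eqF.
Qed.

Let Binv_cvg : (fun n => (B ^+ n)^-1) @ \oo --> (0 : R).
Proof.
have -> : (fun n => (B ^+ n)^-1) = (fun n => B^-1 ^+ n).
  by apply/funext => n; rewrite exprVn.
apply: cvg_expr; rewrite ger0_norm ?invr_ge0 ?ltW//.
by rewrite invf_lt1 //; have := B2; lra.
Qed.

Lemma bary_expansion_exists : exists x : nat -> 'I_b, is_bary_expansion xi x.
Proof.
exists a; split.
  have -> : xi - (Num.floor xi)%:~R = t 0 - 0.
    by rewrite /t /F expr0 mul1r subr0.
  have -> : series (fun j => (a j)%:R / b%:R ^+ j.+1)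
          = (fun n => t 0 - t n / B ^+ n).
    by apply/funext => n; rewrite -partial.
  apply: cvgB; first exact: cvg_cst.
  apply: (@squeeze_cvgr _ _ _ _ (fun=> 0) (fun n => (B ^+ n)^-1)) => //.
  - near=> n; apply/andP; split.
      by rewrite divr_ge0 // exprn_ge0 // ltW.
    by rewrite ler_piMl ?invr_ge0 ?exprn_ge0 // ltW.
  - exact: cvg_cst.
move=> /finite_nat_bounded [N hN].
have aN j : (N <= j)%N -> (a j)%:R = B - 1.
  move=> /hN /negP /negPn /eqP ->.
  by rewrite -subn1 natrB // ltnW.
have tN k : 1 - t (N + k) = B ^+ k * (1 - t N).
  elim: k => [|k IH]; first by rewrite addn0 mul1r.
  have := aE (N + k); rewrite aN ?leq_addr // addnS exprS -mulrA -IH; lra.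
have tN0 : 0 < 1 - t N by rewrite subr_gt0.
have small : (fun k => (B ^+ k)^-1) @ \oo --> (0 : R) := Binv_cvg.
have /cvgrPdist_lt/(_ _ tN0)[k _ /(_ k (leqnn k))] := small.
rewrite /= sub0r normrN gtr0_norm ?invr_gt0 ?exprn_gt0 //.
rewrite -[X in X < _]mul1r ltr_pdivrMr ?exprn_gt0 // mulrC -tN.
by have := t_ge0 (N + k); lra.
Unshelve. all: by end_near.
Qed.

Section unique.
Context (x : nat -> 'I_b) (hx : is_bary_expansion xi x).

Let S := series (fun j => (x j)%:R / B ^+ j.+1).
Let r n : R := B ^+ n * (xi - (Num.floor xi)%:~R - S n).

Let Bn_gt0 n : 0 < B ^+ n. Proof. exact: exprn_gt0. Qed.

Let rS n : r n.+1 = B * r n - (x n)%:R.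
Proof.
have B_neq0 : B != 0 by rewrite gt_eqF.
have Bn_neq0 : B ^+ n != 0 by rewrite gt_eqF.
by rewrite /r /S seriesSr !exprS; field; rewrite B_neq0 Bn_neq0.
Qed.

Let x_le n : (x n)%:R <= B - 1.
Proof. by rewrite lerBrDr natr1 ler_nat. Qed.

Let r_ge0 n : 0 <= r n.
Proof.
apply: mulr_ge0; first exact/ltW.
rewrite subr_ge0.
rewrite -(cvg_lim _ hx.1) //; apply: nondecreasing_cvgn_le.
  apply/nondecreasing_seqP => k.
  by rewrite [leRHS]seriesSr lerDl divr_ge0 // exprn_ge0 // ltW.
by apply/cvg_ex; eexists; exact: hx.1.
Qed.

Let r_le1 n : r n <= 1.
Proof.
pose U k := S k + (B ^+ k)^-1.
have Ucvg : U @ \oo --> xi - (Num.floor xi)%:~R.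
  by rewrite -[X in _ --> X]addr0; apply: cvgD; [exact: hx.1|exact: Binv_cvg].
have Uni : nonincreasing_seq U.
  apply/nonincreasing_seqP => k; rewrite /U /S seriesSr -addrA lerD2l.
  rewrite -[X in _ + X]mul1r -mulrDl ler_pdivrMr // exprS mulrCA.
  by rewrite mulVf ?gt_eqF // mulr1; have := x_le k; lra.
have : xi - (Num.floor xi)%:~R <= U n.
  rewrite -(cvg_lim _ Ucvg) //; apply: nonincreasing_cvgn_ge => //.
  by apply/cvg_ex; eexists; exact: Ucvg.
rewrite /U -lerBlDl => h.
by rewrite /r mulrC -ler_pdivlMr // div1r.
Qed.

Let r_lt1 n : r n < 1.
Proof.
rewrite lt_neqAle r_le1 andbT; apply/eqP => rn1.
apply: hx.2; apply: (sub_finite_set _ (finite_II n)) => j /= /eqP xj.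
rewrite ltnNge; apply/negP => nj; apply: xj.
have rk k : r (n + k) = 1.
  elim: k => [|k IH]; first by rewrite addn0.
  have := r_le1 (n + k).+1; have := x_le (n + k).
  rewrite addnS rS IH; lra.
have := rS j; have := rk (j - n)%N; have := rk (j.+1 - n)%N.
rewrite !subnKC ?leqW // => -> -> h.
have {}h : (x j).+1%:R = B by rewrite -natr1; lra.
move/eqP: h; rewrite /B eqr_nat => /eqP h; exact: (congr1 predn h).
Qed.

Let rE n : r n = t n.
Proof.
elim: n => [|n IH].
  by rewrite /r /t /F /S /series /= big_geq // subr0 !expr0 !mul1r.
have h : (d n - (x n)%:Z)%:~R = r n.+1 - t n.+1.
  by rewrite rS IH rmorphB /= dE; ring.
suff /eqP : d n - (x n)%:Z = 0.
  by rewrite -(eqr_int R) h subr_eq0 => /eqP.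
have := r_ge0 n.+1; have := r_lt1 n.+1.
have := t_ge0 n.+1; have := t_lt1 n.+1 => h1 h2 h3 h4.
have : (-1)%:~R < (d n - (x n)%:Z)%:~R :> R by rewrite h; lra.
have : (d n - (x n)%:Z)%:~R < 1%:~R :> R by rewrite h; lra.
rewrite !ltr_int; lia.
Qed.

Lemma bary_digitE n : (x n)%:R = B * t n - t n.+1.
Proof. by rewrite -!rE rS; ring. Qed.
End unique.

Lemma bary_expansion_uniq (x y : nat -> 'I_b) :
  is_bary_expansion xi x -> is_bary_expansion xi y -> x = y.
Proof.
move=> hx hy; apply/funext => n; apply/val_inj/eqP.
by rewrite /= -(eqr_nat R) (bary_digitE hx) (bary_digitE hy).
Qed.
End expansion_unique.

Definition bary_expansion (R : realType) (b : nat) (hb : (1 < b)%N) (xi : R) :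
  nat -> 'I_b := sval (cid (bary_expansion_exists hb xi)).

Lemma bary_expansionP (R : realType) (b : nat) (hb : (1 < b)%N) (xi : R) :
  is_bary_expansion xi (bary_expansion hb xi).
Proof. exact: svalP (cid (bary_expansion_exists hb xi)). Qed.

Definition bary_complexity (R : realType) (b : nat) (hb : (1 < b)%N) (xi : R)
  (n : nat) : nat := subword_complexity (bary_expansion hb xi) n.

(* The non-finite case of the next two definitions is the limit of the formula
   as m tends to +oo; -oo is not the exponent of any number. *)
Definition liminf_bound (R : realType) (mu : \bar R) : R :=
  if mu is m%:E then
    1 + (- m ^+ 3 + 2 * m ^+ 2 + m - 1) /
        (m ^+ 4 - 2 * m ^+ 3 + 3 * m ^+ 2 - 3 * m + 1)
  else 1.

Definition limsup_bound (R : realType) (mu : \bar R) : R :=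
  if mu is m%:E then
    (m + Num.sqrt (4 * (m - 1) ^+ 3 + m ^+ 2)) / (2 * m * (m - 1))
  else 0.

(* Main.v *)
Require Import Defs.
From mathcomp Require Import all_boot all_order all_algebra.
From mathcomp Require Import all_classical all_reals all_analysis.
From mathcomp Require Import ring lra zify.
Set Implicit Arguments.
Unset Strict Implicit.
Unset Printing Implicit Defensive.
Import Order.TTheory GRing.Theory Num.Theory.
Import numFieldNormedType.Exports.
Local Open Scope classical_set_scope.
Local Open Scope ring_scope.

(** Write [l = mu - 1] and [p] for the complexity function.  Both bounds follow
from a single stronger one: if [l ^ 3 < l + 1], then the lower limit of
[p n / n] is at least [slope l = 1 / l + l / (1 + l) ^ 2], which is [5 / 4] for
[mu = 2].  When [l ^ 3 >= l + 1] or [mu] is infinite, the two bounds of the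
theorem are at most [1], and [p n >= n] holds for every word that is not
eventually periodic.  That [l >= 1] is the theorem of Dirichlet.

The arithmetic enters through [bary_sparse_repetitions].  If the same block of
length [m] is read from positions [i < j] of the expansion, then the fractional
parts of [b ^ i * xi] and [b ^ j * xi] differ by at most [b ^ - m], so that [xi] is
very close to a rational number of denominator [b ^ j - b ^ i].  The definition
of [mu] then forces [m <= l' * (j + C)] for any fixed [l' > l]: long repetitions
cannot occur early.

The rest is combinatorics of words.  As [slope l <= 2], an induction on [n]
([complexity_linear]) leaves only the lengths with [p (n + 1) <= p n + 1].  For
these exactly one block [B] of length [n] is right special, and the graph whose
vertices are the blocks of length [n] is very simple: a tail leading from the
beginning of the word to [B], and two loops [U] and [V] from [B] to itself, of
lengths [a] and [b], which merge [s] steps before they return to [B].  If [t]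
vertices of the tail lie on no loop, then [p n >= t + a + b - s - 1].  The word
is read by following the tail and then the loops in some order, the first one
being called [U], and every return to a vertex is a repetition.  According to
the place where the tail meets the loops, [return_structure] lists two or three
such repetitions; bounding them by the arithmetic condition and eliminating the
unknown lengths gives [t + a + b >= slope l * (n + s)] (lemmas [slope_le_...]),
whence the claim, because [slope l >= 1].  That [a + b >= n + s], used in each
elimination, is a form of the theorem of Fine and Wilf
([overlap_of_two_periods]). *)

(** * Blocks of a word and its complexity *)

Section Words.
Local Open Scope nat_scope.
Context (A : finType) (x : nat -> A).
Implicit Types i j k l m n : nat.

Definition agree m i j := forall k, k < m -> x (i + k) = x (j + k).

Lemma agree_sym m i j : agree m i j -> agree m j i.
Proof. by move=> H k km; rewrite H. Qed.

Lemma agree_trans m i j k : agree m i j -> agree m j k -> agree m i k.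
Proof. by move=> H1 H2 l lm; rewrite H1 // H2. Qed.

Lemma agree_sub m i j l m' : agree m i j -> l + m' <= m ->
  agree m' (i + l) (j + l).
Proof. by move=> H lm k km; rewrite -!addnA H //; lia. Qed.

Lemma agreeW m m' i j : agree m i j -> m' <= m -> agree m' i j.
Proof. by move=> H le k km; apply: H; lia. Qed.

Lemma agree_cat l m i j : agree l i j -> agree m (i + l) (j + l) ->
  agree (l + m) i j.
Proof.
move=> H1 H2 k km; case: (ltnP k l) => kl; first exact: H1.
by have := H2 (k - l); rewrite -!addnA subnKC //; apply; lia.
Qed.

Lemma agreeS m i j : agree m i j -> x (i + m) = x (j + m) -> agree m.+1 i j.
Proof.
move=> H e; rewrite -addn1; apply: agree_cat => // k; rewrite ltnS leqn0.
by move/eqP->; rewrite !addn0.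
Qed.

Lemma agree_grow n m i j : agree n i j ->
  (forall l, l < m -> agree n (i + l) (j + l) -> x (i + l + n) = x (j + l + n)) ->
  agree (m + n) i j.
Proof.
move=> H0; elim: m => [//|m IH] H.
have Hm : agree (m + n) i j by apply: IH => l lm; apply: H; lia.
rewrite addSn; apply: agreeS => //; rewrite !addnA; apply: H => //.
exact: agree_sub Hm _.
Qed.

Definition block n i : n.-tuple A := [tuple x (i + k) | k < n].

Lemma block_agree n i j : block n i = block n j <-> agree n i j.
Proof.
split => [E k kn|H].
  have := congr1 (fun t => tnth t (Ordinal kn)) E.
  by rewrite !tnth_mktuple.
by apply: eq_from_tnth => k; rewrite !tnth_mktuple H.
Qed.

Definition language n : {set n.-tuple A} :=
  [set w | `[< exists j, w = block n j >]]%SET.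

Lemma block_lang n i : block n i \in language n.
Proof. by rewrite inE; apply/asboolP; exists i. Qed.

Lemma complexity_ge n (s : seq nat) : uniq s ->
  {in s &, forall i j, agree n i j -> i = j} ->
  size s <= subword_complexity x n.
Proof.
move=> us inj.
have un : uniq (map (block n) s).
  by rewrite map_inj_in_uniq // => i j si sj /block_agree; exact: inj.
rewrite -(size_map (block n)) -(card_uniqP un); apply: subset_leq_card.
by apply/fintype.subsetP => w /mapP[i _ ->]; exact: block_lang.
Qed.

Definition belast_tuple n (w : n.+1.-tuple A) : n.-tuple A :=
  [tuple tnth w (widen_ord (leqnSn n) k) | k < n].

Lemma belast_tuple_block n i : belast_tuple (block n.+1 i) = block n i.
Proof. by apply: eq_from_tnth => k; rewrite !tnth_mktuple. Qed.

(** A set [D] of blocks of length [n + 1] whose prefixes exhaust the blocks of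
length [n], but which is not larger than the set of these, is in bijection with
it: a block of length [n] has only one continuation in [D]. *)
Lemma agreeS_of_card n (D : {set n.+1.-tuple A}) :
  D \subset language n.+1 ->
  (forall i, exists2 j, agree n i j & block n.+1 j \in D) ->
  #|D| <= subword_complexity x n ->
  forall i j, block n.+1 i \in D -> block n.+1 j \in D ->
    agree n i j -> agree n.+1 i j.
Proof.
move=> Dl cov cD.
have Dc : #|[set belast_tuple w | w in D]%SET| == #|D|.
  rewrite eqn_leq leq_imset_card /=; apply: leq_trans cD _.
  apply: subset_leq_card; apply/fintype.subsetP => w; rewrite inE => /asboolP[i ->].
  have [j ij jD] := cov i; apply/imsetP; exists (block n.+1 j) => //.
  by rewrite belast_tuple_block; apply/block_agree.
move/imset_injP: Dc => inj i j Di Dj ij.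
by apply/block_agree/inj => //; rewrite !belast_tuple_block; apply/block_agree.
Qed.

Lemma agree_repeat n M : exists i j, [/\ M <= i, i < j & agree n i j].
Proof.
pose f (k : 'I_#|{: n.-tuple A}|.+1) := block n (M + k).
have : ~~ injectiveb f.
  apply/negP => /injectiveP inj; have := max_card (mem (codom f)).
  by rewrite card_codom // card_ord ltnn.
move/injectivePn => [k [l kl /block_agree]].
have [lt|gt|/val_inj/eqP] := ltngtP k l; last by rewrite (negPf kl).
  by move=> H; exists (M + k), (M + l); split=> //; lia.
by move=> /agree_sym H; exists (M + l), (M + k); split=> //; lia.
Qed.

Definition nonperiodic := forall i j, i < j -> exists m, ~ agree m i j.

Context (np : nonperiodic).

(** Otherwise the word would be deterministic after position [M], and eventually
periodic from the first block that is seen twice there. *)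
Lemma right_special_exists n M :
  exists i j, [/\ M <= i, M <= j, agree n i j & x (i + n) <> x (j + n)].
Proof.
apply: contrapT => no.
have [i [j [Mi ij H]]] := agree_repeat n M.
have [m []] := np ij.
apply: (@agreeW (m + n)); last by lia.
apply: agree_grow => // l _ Hl; apply: contrapT => ne.
by apply: no; exists (i + l), (j + l); split => //; lia.
Qed.

(** One half of the theorem of Morse and Hedlund. *)
Lemma complexity_ltS n : subword_complexity x n < subword_complexity x n.+1.
Proof.
rewrite ltnNge; apply/negP => le.
have [i [j [_ _ ij ne]]] := right_special_exists n 0.
have := @agreeS_of_card n (language n.+1) (subxx _) _ le i j
  (block_lang _ _) (block_lang _ _) ij.
move=> H; apply: ne; apply: H => //= k; exists k => //; exact: block_lang.
Qed.

Lemma complexity_geid n : n <= subword_complexity x n.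
Proof. by elim: n => // n IH; exact: leq_ltn_trans IH (complexity_ltS n). Qed.


Lemma ex_min_nat (Q : nat -> Prop) : (exists i, Q i) ->
  exists i, Q i /\ forall j, j < i -> ~ Q j.
Proof.
move=> [i Qi]; have ex : exists i, `[< Q i >] by exists i; apply/asboolP.
case: (ex_minnP ex) => m /asboolP Qm mi; exists m; split=> // j jm Qj.
by have := mi j; rewrite leqNgt jm => /(_ (introT (asboolP _) Qj)).
Qed.

Lemma ex_max_nat (Q : nat -> Prop) N : (exists i, Q i) ->
  (forall i, Q i -> i <= N) -> exists i, Q i /\ forall j, i < j -> ~ Q j.
Proof.
move=> [i Qi] H; have ex : exists i, `[< Q i >] by exists i; apply/asboolP.
have bd j : `[< Q j >] -> j <= N by move/asboolP; exact: H.
case: (ex_maxnP ex bd) => m /asboolP Qm mi; exists m; split=> // j jm Qj.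
by have := mi j; rewrite leqNgt jm => /(_ (introT (asboolP _) Qj)).
Qed.

(** If complexity grows by one only, then removing a single block of length
[n + 1], one of two continuations of the same block, makes continuations
unique. *)
Lemma determinism_off_branch n e f : subword_complexity x n.+1 <= (subword_complexity x n).+1 ->
  agree n e f -> x (e + n) <> x (f + n) ->
  forall i j, agree n i j -> ~ agree n.+1 i f -> ~ agree n.+1 j f ->
    x (i + n) = x (j + n).
Proof.
move=> le ef ne i j ij nif njf.
pose D := (language n.+1 :\ block n.+1 f)%SET.
have inD k : ~ agree n.+1 k f -> block n.+1 k \in D.
  by move=> H; rewrite !in_setD1 block_lang andbT; apply/eqP => /block_agree.
suff H : agree n.+1 i j by apply: H.
apply: (@agreeS_of_card n D) => //; try exact: inD.
- by rewrite /D subD1set.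
- move=> k; case: (pselect (agree n.+1 k f)) => kf.
    exists e; first exact: agree_trans (agreeW kf (leqnSn n)) (agree_sym ef).
    by apply: inD => H; apply: ne; apply: H.
  by exists k => //; exact: inD.
have := cardsD1 (block n.+1 f) (language n.+1); rewrite block_lang /= add1n.
by move=> E; rewrite -ltnS -/D -E.
Qed.

(** The first equality of blocks says that [x] has period [a] from [q - a] up to
[q + n], where this period fails; the second one gives it period [b] from [q - s]
to beyond [q + n].  If the overlap, of length [n + s], were longer than [a + b],
the two periods would carry the first one over to position [q + n]. *)
Lemma overlap_of_two_periods n s a b q : 0 < b -> s < a -> a <= q ->
  agree n (q - a) q -> agree (s + n) (q - s) (q + b - s) ->
  x (q - a + n) <> x (q + n) -> n + s <= a + b.
Proof.
move=> b0 sa aq Aa Ab ne; rewrite leqNgt; apply/negP => lt; apply: ne.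
have Hb y : q - s <= y -> y < q + n -> x y = x (y + b).
  move=> y1 y2; have := Ab (y - (q - s)).
  have -> : q - s + (y - (q - s)) = y by lia.
  have -> : q + b - s + (y - (q - s)) = y + b by lia.
  by apply; lia.
have Ha y : q - a <= y -> y < q - a + n -> x y = x (y + a).
  move=> y1 y2; have := Aa (y - (q - a)).
  have -> : q - a + (y - (q - a)) = y by lia.
  have -> : q + (y - (q - a)) = y + a by lia.
  by apply; lia.
(* Go back by [b], then by [a], and return in the other order. *)
symmetry.
have -> : q + n = q + n - b + b by lia.
rewrite -Hb; try lia.
have -> : q + n - b = q + n - a - b + a by lia.
rewrite -Ha; try lia.
have -> : q - a + n = q + n - a - b + b by lia.
by apply: Hb; lia.
Qed.

(** * Lengths with a single right special block *)

Section OneRightSpecial.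
Context (n : nat).
Context (hn : subword_complexity x n.+1 <= (subword_complexity x n).+1).

Definition repetition m j := exists2 i, i < j & agree m i j.

(** The block at [e0] is the right special one, taken at its first occurrence.
Letters are determined elsewhere, and after this block only two letters are
possible: the one that follows position [e0 + n - 1] and another one, both of
which occur arbitrarily far. *)
Lemma right_special_unique : exists e0,
  [/\ forall i, i < e0 -> ~ agree n e0 i,
      forall i j, agree n i j -> ~ agree n e0 i -> x (i + n) = x (j + n),
      forall i j, agree n e0 i -> agree n e0 j ->
        (x (i + n) = x (e0 + n) <-> x (j + n) = x (e0 + n)) ->
        x (i + n) = x (j + n) &
      forall M, (exists2 i, M <= i & agree n e0 i /\ x (i + n) = x (e0 + n)) /\
        (exists2 i, M <= i & agree n e0 i /\ x (i + n) <> x (e0 + n))].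
Proof.
have [i0 [j0 [_ _ ij0 ne0]]] := right_special_exists n 0.
have [e0 [ie0 mine0]] := @ex_min_nat (agree n i0) (ex_intro _ i0 (fun _ _ => erefl)).
have [f e0f ne] : exists2 f, agree n e0 f & x (e0 + n) <> x (f + n).
  have [E|N] := pselect (x (e0 + n) = x (i0 + n)); last first.
    by exists i0 => //; exact: agree_sym.
  by exists j0; [exact: agree_trans (agree_sym ie0) ij0|rewrite E].
have det1 i j : agree n i j -> ~ agree n e0 i -> x (i + n) = x (j + n).
  move=> ij ni; have := determinism_off_branch hn e0f ne ij; apply => H; apply: ni.
    exact: agree_trans e0f (agree_sym (agreeW H (leqnSn n))).
  apply: agree_trans e0f _; apply: agree_trans (agree_sym ij).
  exact: agree_sym (agreeW H (leqnSn n)).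
have det2 i j : agree n e0 i -> agree n e0 j ->
    (x (i + n) = x (e0 + n) <-> x (j + n) = x (e0 + n)) -> x (i + n) = x (j + n).
  move=> Pi Pj H; case: (pselect (x (i + n) = x (e0 + n))) => Ui.
    by rewrite Ui; symmetry; apply/H.
  apply: (determinism_off_branch hn (agree_sym e0f) (fun E => ne (esym E))).
  - exact: agree_trans (agree_sym Pi) Pj.
  - by move=> K; apply: Ui; apply: K.
  - by move=> K; apply: Ui; apply/H; apply: K.
exists e0; split => //.
  by move=> i /mine0 H K; apply: H; exact: agree_trans ie0 K.
move=> M; have [i [j [Mi Mj ij nij]]] := right_special_exists n M.
have Pi : agree n e0 i by apply: contrapT => K; apply: nij; exact: det1.
have Pj : agree n e0 j by exact: agree_trans Pi ij.
case: (pselect (x (i + n) = x (e0 + n))) => Ui;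
  case: (pselect (x (j + n) = x (e0 + n))) => Uj.
- by rewrite Ui Uj in nij.
- by split; [exists i|exists j].
- by split; [exists j|exists i].
- by case: nij; apply: det2 => //; split.
Qed.

(** With the loops and the tail described at the top: [kap] is the total length
of the copies of [U] that follow the first one before [V] is taken.  The four
alternatives are: the tail meets [V], [v] steps before the common part of the
loops; [U] is run through twice at the start, the tail not being as in the first
alternative; the tail meets [U], [v] steps before the common part; and the tail
meets the loops inside their common part, [sg] steps after its beginning.  In the
last one, [kap'] is the total length of the copies of [V] between the first [V]
and the next [U]. *)
Lemma return_structure : exists t a b s kap : nat,
  [/\ t + a + b <= subword_complexity x n + s + 1, n + s <= a + b,
      s <= a, s <= b &
  [\/ exists v, [/\ repetition (n + s + kap) (t + v + a),
                    repetition (n + s + v) (t + a + b + kap) &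
                    repetition (n + s + v - b) (t + b)],
      repetition (n + a) (t + a),
      exists v, repetition (n + s + v) (t + a) /\
                repetition (n + s - b) (t + v + b) |
      exists sg kap', [/\ sg <= s, repetition (n + s - sg) (t + a),
                    repetition (n + s + kap') (t + a + b - sg) &
                    repetition (n + s - sg + a) (t + a + b + kap')]]].
Proof.
have [e0 [first det1 det2 rec]] := right_special_unique.
(* [P] marks the occurrences of the right special block, and [U] those which
   are followed by the same letter as the first one, i.e. start a loop [U]. *)
pose P i := agree n e0 i.
pose U i := x (i + n) = x (e0 + n).
have P0 : P e0 by [].
have PP i j : P i -> P j -> agree n i j.
  by move=> Pi Pj; exact: agree_trans (agree_sym Pi) Pj.
have Pa i j : P i -> agree n i j -> P j by move=> Pi; exact: agree_trans.
have nxt i : exists g, [/\ 0 < g, P (i + g) & forall l, 0 < l < g -> ~ P (i + l)].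
  have [|g [[g0 Pg] ming]] := @ex_min_nat (fun g => 0 < g /\ P (i + g)).
    have [[j ij [Pj _]] _] := rec i.+1.
    by exists (j - i); split; [lia|rewrite subnKC //; lia].
  by exists g; split=> // l /andP[l0 lg] Pl; apply: (ming l lg).
(* Equal blocks are followed by equal paths up to the next occurrence; [loop]
   is the same for paths which start at occurrences of the same type. *)
have travel h y y' : agree n y y' -> (forall l, l < h -> ~ P (y + l)) ->
    agree (h + n) y y'.
  move=> H no; apply: agree_grow => // l lh Hl; apply: det1 => //; exact: no.
have loop h y y' : P y -> P y' -> (U y <-> U y') ->
    (forall l, 0 < l < h -> ~ P (y + l)) -> 0 < h -> agree (h + n) y y'.
  move=> Py Py' UU no h0; apply: agree_grow; first exact: PP.
  move=> [|l] lh Hl; first by rewrite !addn0; exact: det2.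
  by apply: det1 => //; apply: no; rewrite lh.
(* The word runs through copies of [U] from [e0] to [q], then through copies of
   [V] from [q] to [z], and then takes [U] again. *)
have [a [a0 Pe1 noa]] := nxt e0.
have [|q [[q0 [Pq Vq]] minq]] := @ex_min_nat (fun i => e0 <= i /\ P i /\ ~ U i).
  by have [_ [i]] := rec e0; exists i.
have Uq i : e0 <= i -> i < q -> P i -> U i.
  by move=> ei iq Pi; apply: contrapT => nU; apply: (minq i).
have [b [b0 Pqb nob]] := nxt q.
have [|z [[qz [Pz Uz]] minz]] := @ex_min_nat (fun i => q < i /\ P i /\ U i).
  by have [[i qi H] _] := rec q.+1; exists i.
have Vz i : q <= i -> i < z -> P i -> ~ U i.
  move=> qi iz Pi Ui; apply: (minz i) => //; split=> //.
  by rewrite ltn_neqAle qi andbT; apply/eqP => E; apply: Vq; rewrite E.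
have qe0 : e0 < q.
  by rewrite ltn_neqAle q0 andbT; apply/eqP => E; apply: Vq; rewrite -E.
have aq : e0 + a <= q.
  rewrite leqNgt; apply/negP => lt; apply: (noa (q - e0)); first by lia.
  by rewrite subnKC.
have qbz : q + b <= z.
  rewrite leqNgt; apply/negP => lt; apply: (nob (z - q)); first by lia.
  by rewrite subnKC // ltnW.
pose kap := q - e0 - a.
have qE : q = e0 + a + kap by rewrite /kap; lia.
pose kap' := z - q - b.
have zE : z = q + b + kap' by rewrite /kap'; lia.
have runU : agree (kap + n) e0 (e0 + a).
  apply: agree_grow; first exact: Pe1.
  move=> l lk Hl; case: (pselect (P (e0 + l))) => Pl; last exact: det1.
  apply: det2 => //; first exact: (Pa _ _ _ Hl).
  by split => _; apply: Uq => //; try lia; exact: (Pa _ _ _ Hl).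
have runV : agree (kap' + n) q (q + b).
  apply: agree_grow; first exact: PP.
  move=> l lk Hl; case: (pselect (P (q + l))) => Pl; last exact: det1.
  apply: det2 => //; first exact: (Pa _ _ _ Hl).
  have Pl' := Pa (q + l) (q + b + l) Pl Hl.
  by split => H; [case: (Vz (q + l)) | case: (Vz (q + b + l))] => //; lia.
have Pqa : P (q - a).
  apply: (@Pa q) => //; apply: agree_sym.
  have -> : q - a = e0 + kap by lia.
  have -> : q = e0 + a + kap by lia.
  by apply: agree_sub runU _; lia.
have Uqa : U (q - a) by apply: Uq => //; lia.
have Pzb : P (z - b).
  apply: (@Pa z) => //; apply: agree_sym.
  have -> : z - b = q + kap' by lia.
  have -> : z = q + b + kap' by lia.
  by apply: agree_sub runV _; lia.
have nUzb : ~ U (z - b) by apply: Vz => //; lia.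
have loopU : agree (a + n) e0 (q - a) by apply: loop => //; split.
have loopUz : agree (a + n) e0 z by apply: loop => //; split.
have loopV : agree (b + n) q (z - b) by apply: loop => //; split.

(* Paths of length [h] ending at [E] and [E'] visit the same blocks. *)
pose suf h E E' := [/\ h <= E, h <= E' & agree (h + n) (E - h) (E' - h)].
have sufC h E E' : suf h E E' -> suf h E' E.
  by case=> h1 h2 H; split => //; exact: agree_sym.
have sufW h h' E E' : suf h E E' -> h' <= h -> suf h' E E'.
  case=> h1 h2 H le; split; try lia.
  have -> : E - h' = E - h + (h - h') by lia.
  have -> : E' - h' = E' - h + (h - h') by lia.
  by apply: agree_sub H _; lia.
have sufT h E1 E2 E3 : suf h E1 E2 -> suf h E2 E3 -> suf h E1 E3.
  by case=> h1 h2 H [h3 h4 H']; split=> //; exact: agree_trans H H'.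
have suf_run h m E E' : suf h E E' -> agree m E E' -> agree (h + m) (E - h) (E' - h).
  case=> h1 h2 H H'; apply: agree_cat; first by apply: agreeW H _; lia.
  by rewrite !subnK.
have suf0 E E' : P E -> P E' -> suf 0 E E'.
  by move=> PE PE'; split => //; rewrite !subn0; exact: PP.
pose e1 := e0 + a.
have suf_e1q h : h <= a -> suf h e1 q.
  move=> ha; split; try by rewrite /e1; lia.
  have -> : e1 - h = e0 + (a - h) by rewrite /e1; lia.
  have -> : q - h = q - a + (a - h) by lia.
  by apply: agree_sub loopU _; lia.
(* [s] measures the common end of the loops, the one [U] and the other [V]. *)
have [|i [? _ _]|s [sufs maxs]] := @ex_max_nat (fun h => suf h q (q + b)) q.
- by exists 0; exact: suf0.
- by [].
have noq l : 0 < l < a -> ~ P (q - a + l).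
  move=> la Pl; apply: (noa l) => //; apply: Pa Pl _; apply: agree_sym.
  by apply: agree_sub loopU _; lia.
have [sa sb] : s < a /\ s < b.
  suff : s < minn a b by rewrite leq_min => /andP.
  rewrite ltnNge; apply/negP => /(sufW _ _ _ _ sufs).
  case: (ltngtP a b) => ab [_ _ H].
  - apply: (nob (b - a)); first by lia.
    have -> : q + (b - a) = q + b - a by lia.
    by apply: Pa Pqa _; apply: agreeW H _; lia.
  - apply: (noq (a - b)); first by lia.
    have -> : q - a + (a - b) = q - b by lia.
    apply: Pa Pq _; apply: agree_sym; rewrite addnK in H.
    by apply: agreeW H _; lia.
  - apply: Vq; rewrite /U -Uqa; rewrite -ab addnK in H.
    by symmetry; apply: H; lia.
have fw : n + s <= a + b.
  apply: (@overlap_of_two_periods n s a b q) => //; first by lia.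
  - exact: PP.
  - by case: sufs.
  - by move=> E; apply: Vq; rewrite /U -E.
(* [u] measures how far back from [e0] the tail still follows a loop. *)
have [|i|u [sufu maxu]] :=
    @ex_max_nat (fun h => suf h e0 e1 \/ suf h e0 (q + b)) e0.
- by exists 0; left; exact: suf0.
- by case=> -[].
have ue0 : u <= e0 by case: sufu => -[].
pose t := e0 - u.
pose hits y h := P (y + h) /\ forall l, l < h -> ~ P (y + l).
have hits_eq y y' h h' : agree n y y' -> hits y h -> hits y' h' ->
    h = h' /\ agree (h + n) y y'.
  move=> H [Ph nh] [Ph' nh'].
  have A1 := travel _ _ _ H nh.
  have A2 := travel _ _ _ (agree_sym H) nh'.
  split=> //; case: (ltngtP h h') => // lt.
    by case: (nh' h lt); apply: Pa Ph _; apply: agree_sub A1 _.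
  by case: (nh h' lt); apply: Pa Ph' _; apply: agree_sub A2 _.
(* The listed positions are the tail before the loops, the loop [U], and the
   part of [V] before it merges with [U]; blocks are told apart by the number of
   steps to the next occurrence and by the path leading there. *)
have count : t + a + b <= subword_complexity x n + s + 1.
  pose L := iota 0 t ++ iota e0 a ++ iota q.+1 (b - s - 1).
  have hitL y : y \in L -> exists h, hits y h /\
     [\/ y + h = e0 /\ (h = 0 \/ u < h), y + h = e1 /\ 0 < h < a |
         y + h = q + b /\ s < h < b].
    rewrite !mem_cat !mem_iota => /orP[yt|/orP[ya|yb]].
    - exists (e0 - y); split; last by apply: Or31; rewrite /t in yt; lia.
      split; first by have -> : y + (e0 - y) = e0 by lia.
      by move=> l ly; apply: first; lia.
    - case: (ltngtP e0 y) => [ey||<-]; [|lia|].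
        exists (e1 - y); split; last by apply: Or32; rewrite /e1; lia.
        split; first by have -> : y + (e1 - y) = e0 + a by rewrite /e1; lia.
        move=> l; rewrite /e1 => ly.
        have -> : y + l = e0 + (y - e0 + l) by lia.
        by apply: noa; lia.
      exists 0; split; last by apply: Or31; rewrite addn0; split=> //; left.
      by split=> //; rewrite addn0.
    - exists (q + b - y); split; last by apply: Or33; lia.
      split; first by have -> : y + (q + b - y) = q + b by lia.
      move=> l ly.
      have -> : y + l = q + (y - q + l) by lia.
      by apply: nob; lia.
  have sizeL : size L = t + a + (b - s - 1) by rewrite !size_cat !size_iota addnA.
  have uL : uniq L.
    rewrite !cat_uniq !iota_uniq /= andbT; apply/andP; split.
      apply/hasPn => y; rewrite mem_cat !mem_iota /t; lia.
    by apply/hasPn => y; rewrite !mem_iota; lia.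
  suff : size L <= subword_complexity x n by rewrite sizeL; lia.
  apply: complexity_ge => // y y' /hitL[h [Hh c]] /hitL[h' [Hh' c']] yy'.
  have [E Ag] := hits_eq _ _ _ _ yy' Hh Hh'; subst h'.
  have sufyy : suf h (y + h) (y' + h) by split; [lia..|rewrite !addnK].
  case: c => -[E c]; case: c' => -[E' c']; try lia; rewrite E E' in sufyy.
  - by case: (maxu h); [lia|left].
  - by case: (maxu h); [lia|right].
  - by case: (maxu h); [lia|left; exact: sufC].
  - case: (maxs h); first by lia.
    by apply: sufT sufyy; apply: sufC; apply: suf_e1q; lia.
  - by case: (maxu h); [lia|right; exact: sufC].
  - case: (maxs h); first by lia.
    by apply: sufC; apply: sufT sufyy _; apply: suf_e1q; lia.
have suf_e1qb h : h <= s -> suf h e1 (q + b).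
  move=> hs; apply: sufT (suf_e1q h _) _; first by lia.
  exact: sufW sufs _.
have kap_big : 0 < kap -> a <= kap.
  move=> k0; rewrite leqNgt; apply/negP => lt; apply: (noa kap); first by lia.
  by have <- : q - a = e0 + kap by lia.
have rep1 h : suf h e0 e1 -> agree (h + (kap + n)) (e0 - h) (e0 + a - h).
  by move=> H; exact: suf_run.
exists t, a, b, s, kap; split=> //; try by lia.
(* The tail enters the loops inside their common part. *)
have [us|us] := leqP u s.
  have [uU uV] : suf u e0 e1 /\ suf u e0 (q + b).
    have H := suf_e1qb u us.
    case: sufu => H'; split=> //; first exact: sufT H' H.
    exact: sufT H' (sufC _ _ _ H).
  have [k0|k0] := posnP kap; last first.
    apply: Or42; exists t; first by lia.
    have -> : t + a = e0 + a - u by rewrite /t; lia.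
    by apply: agreeW (rep1 _ uU) _; have := kap_big k0; lia.
  apply: Or44; exists (s - u), kap'; split; first by lia.
  - exists t; first by lia.
    have -> : t + a = e0 + a - u by rewrite /t; lia.
    by apply: agreeW (rep1 _ uU) _; lia.
  - exists (q - s); first by rewrite /t; lia.
    have -> : t + a + b - (s - u) = q + b - s by rewrite /t; lia.
    by apply: agreeW (suf_run _ _ _ _ sufs runV) _; lia.
  - exists t; first by lia.
    have -> : t + a + b + kap' = z - u by rewrite /t; lia.
    apply: (@agreeW (u + (a + n))); last by lia.
    apply: suf_run loopUz; apply: (sufT _ _ _ _ uV).
    split; try lia.
    have -> : q + b - u = q + (b - u) by lia.
    have -> : z - u = z - b + (b - u) by lia.
    by apply: agree_sub loopV _; lia.
(* The tail enters through [U]: the common end of the loops, read from the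
   first return, has period [b], and is copied back to the first occurrence. *)
case: sufu => sufu.
  have [k0|k0] := posnP kap; last first.
    apply: Or42; exists t; first by lia.
    have -> : t + a = e0 + a - u by rewrite /t; lia.
    by apply: agreeW (rep1 _ sufu) _; have := kap_big k0; lia.
  apply: Or43; exists (u - s); split.
    exists t; first by lia.
    have -> : t + a = e0 + a - u by rewrite /t; lia.
    by apply: agreeW (rep1 _ sufu) _; lia.
  exists (e0 - s); first by rewrite /t; lia.
  have -> : t + (u - s) + b = e0 - s + b by rewrite /t; lia.
  have [_ _ Hu] := sufW _ _ _ _ sufu (ltnW us).
  case: sufs => _ _ Hs.
  have e1q : e1 = q by rewrite /e1; lia.
  move=> k kn; rewrite Hu; last by lia.
  rewrite -addnA Hu ?e1q; last by lia.
  rewrite Hs; last by lia.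
  by congr x; lia.
(* The tail enters through [V], so that it has period [b] up to the end of the
   first occurrence; a full turn of [V] would contain an earlier occurrence. *)
have ub : u < b.
  rewrite ltnNge; apply/negP => bu.
  have [be _ H] := sufW _ _ _ _ sufu bu.
  apply: (first (e0 - b)); first by lia.
  apply: Pa Pq _; apply: agree_sym; rewrite addnK in H.
  by apply: agreeW H _; lia.
apply: Or41; exists (u - s); split.
- exists (e0 - s); first by rewrite /t; lia.
  have -> : t + (u - s) + a = e0 + a - s by rewrite /t; lia.
  apply: (@agreeW (s + (kap + n))); last by lia.
  apply: rep1; apply: sufT (sufW _ _ _ _ sufu (ltnW us)) _.
  by apply: sufC; exact: suf_e1qb.
- exists t; first by lia.
  have -> : t + a + b + kap = q + b - u by rewrite /t; lia.
  by case: sufu => _ _ H; apply: agreeW H _; lia.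
- exists t; first by lia.
  case: sufu => _ _ H k kn.
  have -> : t + b + k = e0 - u + (b + k) by rewrite /t; lia.
  rewrite /t H; last by lia.
  rewrite H; last by lia.
  have := PP _ _ Pq Pqb (b - u + k).
  have -> : q + (b - u + k) = q + b - u + k by lia.
  have -> : q + b + (b - u + k) = q + b - u + (b + k) by lia.
  by apply; lia.
Qed.
End OneRightSpecial.
End Words.

(** * Elimination of the lengths *)

Section Numeric.
Context (R : realFieldType).
Implicit Types l N t a b s v k g : R.

Definition slope l := l^-1 + l / (1 + l) ^+ 2.

Lemma slopeE l : 0 < l ->
  slope l = (2 * l ^+ 2 + 2 * l + 1) / (l * (1 + l) ^+ 2).
Proof. by move=> l0; rewrite /slope; field; apply/andP; split; lra. Qed.

Lemma slope_den_gt0 l : 0 < l -> 0 < l * (1 + l) ^+ 2.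
Proof. by move=> l0; rewrite mulr_gt0 // exprn_gt0 //; lra. Qed.

Lemma slope_ge1 l : 0 < l -> l ^+ 3 <= l + 1 -> 1 <= slope l.
Proof.
by move=> l0 h; rewrite slopeE // ler_pdivlMr ?slope_den_gt0 //; lra.
Qed.

Lemma slope_le2 l : 1 <= l -> slope l <= 2.
Proof.
move=> l1; have l0 : 0 < l by lra.
rewrite slopeE // ler_pdivrMr ?slope_den_gt0 //.
have l2 : 1 <= l ^+ 2 by exact: exprn_ege1.
have l3 : 0 <= l ^+ 3 by rewrite exprn_ge0 //; lra.
lra.
Qed.

Lemma slope_le l N Q : 0 < l ->
  N * (2 * l ^+ 2 + 2 * l + 1) <= Q * (l * (1 + l) ^+ 2) -> slope l * N <= Q.
Proof.
by move=> l0 h; rewrite slopeE // mulrAC ler_pdivrMr ?slope_den_gt0 // mulrC.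
Qed.

Lemma sqr_le_of_cube l : 1 <= l -> l ^+ 3 <= l + 1 -> l ^+ 2 <= l + 1.
Proof. by move=> l1; apply: le_trans; rewrite ler_weXn2l. Qed.

(** Here, as in the three lemmas below, [N] stands for [n + s], and the claim is a
combination of the hypotheses with the multipliers shown.  The condition
[l ^ 3 <= l + 1] gives the unknown [k] a nonnegative coefficient, so that [k = 0]
is the worst case. *)
Lemma slope_le_tail_on_V l N t a b v k : 1 <= l -> l ^+ 3 <= l + 1 -> N <= a + b ->
  0 <= k -> N + k <= l * (t + v + a) ->
  N + v <= l * (t + a + b + k) -> N + v - b <= l * (t + b) ->
  slope l * N <= t + a + b.
Proof.
move=> l1 l3 hN k0 E1 E5 E6; have l0 : 0 < l by lra.
have l2 := sqr_le_of_cube l1 l3; apply: slope_le => //.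
have h1 : 0 <= (1 + l) * (l * (t + v + a) - (N + k)) by rewrite mulr_ge0; lra.
have h6 : 0 <= l * (l * (t + b) - (N + v - b)) by rewrite mulr_ge0; lra.
have h5 : 0 <= l ^+ 2 * (l * (t + a + b + k) - (N + v)).
  by rewrite mulr_ge0 ?exprn_ge0; lra.
have h0 : 0 <= l ^+ 2 * (a + b - N) by rewrite mulr_ge0 ?exprn_ge0; lra.
have hk : 0 <= k * (l + 1 - l ^+ 3) by rewrite mulr_ge0; lra.
lra.
Qed.

(** Eliminating gives the constant [(1 + l) ^ 2 / (l * (2 * l + 1))], which is
larger than [slope l] because [(1 + l) ^ 4 - (2 * l + 1) * (2 * l ^ 2 + 2 * l + 1)] is
[l ^ 4]. *)
Lemma slope_le_tail_on_U l N t a b v : 1 <= l -> l ^+ 3 <= l + 1 -> N <= a + b ->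
  0 <= N -> 0 <= v -> N + v <= l * (t + a) ->
  N - b <= l * (t + v + b) -> slope l * N <= t + a + b.
Proof.
move=> l1 l3 hN N0 v0 E1 E2; have l0 : 0 < l by lra.
have l2 := sqr_le_of_cube l1 l3; apply: slope_le => //.
have h1 : 0 <= l * (l * (t + v + b) - (N - b)) by rewrite mulr_ge0; lra.
have h2 : 0 <= l ^+ 2 * (l * (t + a) - (N + v)).
  by rewrite mulr_ge0 ?exprn_ge0; lra.
have h3 : 0 <= (l + 1 - l ^+ 2) * (l * (t + a) - (N + v) + v).
  by rewrite mulr_ge0; lra.
have h0 : 0 <= l ^+ 2 * (a + b - N) by rewrite mulr_ge0 ?exprn_ge0; lra.
have key : N * (1 + l) ^+ 2 <= (t + a + b) * (l * (2 * l + 1)) by lra.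
rewrite -(@ler_pM2r _ (2 * l + 1)); last by lra.
have h4 : 0 <= (1 + l) ^+ 2 * ((t + a + b) * (l * (2 * l + 1)) - N * (1 + l) ^+ 2).
  by rewrite mulr_ge0 ?exprn_ge0; lra.
have h5 : 0 <= N * l ^+ 4 by rewrite mulr_ge0 ?exprn_ge0; lra.
lra.
Qed.

Lemma slope_le_tail_on_both l N t a b g k : 1 <= l -> l ^+ 3 <= l + 1 -> N <= a + b ->
  0 <= k -> N - g <= l * (t + a) ->
  N + k <= l * (t + a + b - g) -> N - g + a <= l * (t + a + b + k) ->
  slope l * N <= t + a + b.
Proof.
move=> l1 l3 hN k0 E1 E2 E3; have l0 : 0 < l by lra.
have l2 := sqr_le_of_cube l1 l3; apply: slope_le => //.
have h1 : 0 <= l * (l * (t + a) - (N - g)) by rewrite mulr_ge0; lra.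
have h2 : 0 <= (1 + l) * (l * (t + a + b - g) - (N + k)) by rewrite mulr_ge0; lra.
have h3 : 0 <= l ^+ 2 * (l * (t + a + b + k) - (N - g + a)).
  by rewrite mulr_ge0 ?exprn_ge0; lra.
have h0 : 0 <= l ^+ 2 * (a + b - N) by rewrite mulr_ge0 ?exprn_ge0; lra.
have hk : 0 <= k * (l + 1 - l ^+ 3) by rewrite mulr_ge0; lra.
lra.
Qed.

(** Eliminating gives the constant [1 / 2 + 1 / l], which is larger than [slope l]
since [2 * l < (1 + l) ^ 2]. *)
Lemma slope_le_double_U l N t a b s : 1 <= l -> l ^+ 3 <= l + 1 -> N <= a + b ->
  0 <= N -> s <= a -> s <= b -> N - s + a <= l * (t + a) ->
  slope l * N <= t + a + b.
Proof.
move=> l1 l3 hN N0 sa sb E1; have l0 : 0 < l by lra.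
have l2 := sqr_le_of_cube l1 l3; apply: slope_le => //.
have l_le2 : l <= 2.
  rewrite leNgt; apply/negP => l_gt2; have : 0 < l * (l - 2) by rewrite mulr_gt0; lra.
  lra.
have h1 : 0 <= l * (l * (t + a) - (N - s + a)) by rewrite mulr_ge0; lra.
have h2 : 0 <= l * (b - s) by rewrite mulr_ge0; lra.
have h3 : 0 <= l * (a + b - N) by rewrite mulr_ge0; lra.
have h4 : 0 <= (2 - l) * (l * (t + a) - N) by rewrite mulr_ge0; lra.
have key : N * (2 + l) <= (t + a + b) * (2 * l) by lra.
have h5 : 0 <= (1 + l) ^+ 2 * ((t + a + b) * (2 * l) - N * (2 + l)).
  by rewrite mulr_ge0 ?exprn_ge0; lra.
have h6 : 0 <= N * (l ^+ 3 + l) by rewrite mulr_ge0 // addr_ge0 ?exprn_ge0; lra.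
lra.
Qed.

End Numeric.

Lemma natrB_ge (R : realFieldType) (m n : nat) : m%:R - n%:R <= (m - n)%:R :> R.
Proof.
have [h|h] := leqP n m; first by rewrite natrB.
by have := ltnW h; rewrite -(ler_nat R) => h'; have := ler0n R (m - n); lra.
Qed.

(** * Linear growth from sparse repetitions *)

Definition sparse_repetitions (R : realFieldType) (A : finType) (x : nat -> A)
  (l C : R) :=
  forall i j m, (i < j)%N -> agree x m i j -> m%:R <= l * (j%:R + C).

Lemma complexity_ge_oneRS (R : realFieldType) (A : finType) (x : nat -> A)
    (l C : R) n :
  nonperiodic x -> 1 <= l -> l ^+ 3 <= l + 1 -> 0 <= C ->
  sparse_repetitions x l C ->
  (subword_complexity x n.+1 <= (subword_complexity x n).+1)%N ->
  slope l * n%:R <= (subword_complexity x n)%:R + C + 1.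
Proof.
move=> np l1 l3 C0 dio.
move=> /(return_structure np)[t [a [b [s [kap [count fw sa sb cases]]]]]].
have rep m j : repetition x m j -> m%:R <= l * (j%:R + C).
  by case=> i; exact: dio.
(* [C] can be counted as part of the tail: every bound involves [t + C]. *)
suff main : slope l * (n%:R + s%:R) <= t%:R + C + a%:R + b%:R.
  have := count; rewrite -(ler_nat R) !natrD => count'.
  have c1 : 0 <= (slope l - 1) * s%:R.
    by rewrite mulr_ge0 // subr_ge0 slope_ge1 //; lra.
  lra.
have stab : (s <= t + a + b)%N by lia.
move: fw sa sb; rewrite -!(ler_nat R) !natrD => fw sa sb.
have [n0 s0] := (ler0n R n, ler0n R s).
case: cases => [[v [/rep h1 /rep h2 /rep h3]]|/rep h|[v [/rep h1 /rep h2]]|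
    [g [k [gs /rep h1 /rep h2 /rep h3]]]].
- have h3' := le_trans (natrB_ge _ _ _) h3.
  rewrite !natrD in h1 h2 h3'.
  by apply: (@slope_le_tail_on_V _ _ _ _ _ _ v%:R kap%:R) => //; lra.
- rewrite !natrD in h.
  by apply: (@slope_le_double_U _ _ _ _ _ _ s%:R) => //; lra.
- have h2' := le_trans (natrB_ge _ _ _) h2.
  rewrite !natrD in h1 h2'.
  by apply: (@slope_le_tail_on_U _ _ _ _ _ _ v%:R) => //; lra.
have gt : (g <= t + a + b)%N by exact: leq_trans gs stab.
rewrite !natrD !natrB ?natrD // in h1 h2 h3; last by lia.
by apply: (@slope_le_tail_on_both _ _ _ _ _ _ g%:R k%:R) => //; lra.
Qed.

(** Where complexity grows by at least two, it keeps up with a slope at most two;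
elsewhere the lower bound is available directly. *)
Lemma complexity_linear (R : realFieldType) (A : finType) (x : nat -> A)
    (l C : R) :
  nonperiodic x -> 1 <= l -> l ^+ 3 <= l + 1 -> 0 <= C ->
  sparse_repetitions x l C ->
  forall n, slope l * n%:R <= (subword_complexity x n)%:R + C + 3.
Proof.
move=> np l1 l3 C0 dio; have c2 := slope_le2 l1.
elim=> [|n IH]; first by rewrite mulr0 !addr_ge0.
rewrite -natr1 mulrDr mulr1.
have [one|two] := leqP (subword_complexity x n.+1) (subword_complexity x n).+1.
  have h := complexity_ge_oneRS np l1 l3 C0 dio one.
  have := complexity_ltS np n; rewrite -(ltr_nat R) => h'; lra.
move: two; rewrite -(ler_nat R) -addn2 natrD => h; lra.
Qed.

(** * Rational approximation *)

Lemma denq_le_frac (p q : int) : 0 < q -> denq (p%:~R / q%:~R) <= q.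
Proof.
move=> q0; case: (divqP p q) q0 => [_|k r k0 h]; first by rewrite ltxx.
have d0 := denq_gt0 r; rewrite -[leLHS]mul1r ler_pM2r //.
by move: h; rewrite pmulr_lgt0 // => h; lia.
Qed.

Section Rational.
Context (R : realType).
Implicit Types (xi : R) (r : rat).

Lemma irrational_dist_gt0 xi r : irrational xi -> 0 < `|xi - ratr r|.
Proof.
move=> irr; rewrite normr_gt0 subr_eq0; apply/eqP => E; apply: irr.
by exists r.
Qed.

Lemma finite_dist_gt0 xi (E : set rat) : irrational xi -> finite_set E ->
  exists2 e : R, 0 < e & forall r, E r -> e <= `|xi - ratr r|.
Proof.
move=> irr /finite_seqP[s ->]; elim: s => [|r s [e e0 IH]].
  by exists 1 => // r.
exists (Num.min e `|xi - ratr r|).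
  by rewrite lt_min e0 irrational_dist_gt0.
move=> r' /=; rewrite inE => /orP[/eqP->|r's]; rewrite ge_min.
  by rewrite lexx orbT.
by rewrite IH.
Qed.

(** Dirichlet: two of the [M + 1] fractional parts of [0, xi, ..., M xi] fall into
the same interval of length [1 / M]. *)
Lemma dirichlet_approx xi (M : nat) : (0 < M)%N ->
  exists (p q : int), [/\ 0 < q, q <= M%:Z & `|q%:~R * xi - p%:~R| < M%:R^-1].
Proof.
move=> M0; have M0' : 0 < M%:R :> R by rewrite ltr0n.
pose fr (k : nat) : R := k%:R * xi - (Num.floor (k%:R * xi))%:~R.
have fr0 k : 0 <= fr k by rewrite subr_ge0 floor_le.
have fr1 k : fr k < 1.
  have /andP[_] := floor_itv (k%:R * xi); rewrite intrD /fr; lra.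
pose g k : int := Num.floor (M%:R * fr k).
have g0 k : 0 <= g k by rewrite floor_ge0 mulr_ge0 // ltW.
have gM k : (`|g k|%N < M)%N.
  rewrite -ltz_nat gez0_abs // -(ltr_int R).
  apply: le_lt_trans (floor_le _) _.
  by rewrite -[ltRHS]mulr1 ltr_pM2l.
pose f (k : 'I_M.+1) : 'I_M := Ordinal (gM k).
have : ~~ injectiveb f.
  apply/negP => /injectiveP inj; have := max_card (mem (codom f)).
  by rewrite card_codom // !card_ord ltnn.
move/injectivePn => [k0 [l0 kl0 E0]].
wlog kl : k0 l0 kl0 E0 / (k0 < l0)%N.
  move=> H; case: (ltngtP k0 l0) => [h|h|/val_inj h]; [exact: H h| |].
    by apply: (H l0 k0) => //; rewrite eq_sym.
  by rewrite h eqxx in kl0.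
have gE : g k0 = g l0.
  by have /= := congr1 val E0; have := g0 k0; have := g0 l0; lia.
exists (Num.floor (l0%:R * xi) - Num.floor (k0%:R * xi)), (l0%:Z - k0%:Z).
split; first by lia.
  by have := ltn_ord l0; lia.
have -> : (l0%:Z - k0%:Z)%:~R * xi -
    (Num.floor (l0%:R * xi) - Num.floor (k0%:R * xi))%:~R = fr l0 - fr k0.
  by rewrite /fr !rmorphB /=; ring.
have /andP[A1 A2] := floor_itv (M%:R * fr l0).
have /andP[B1 B2] := floor_itv (M%:R * fr k0).
move: A1 A2 B1 B2; rewrite -!/(g _) gE intrD => A1 A2 B1 B2.
rewrite -(ltr_pM2l M0') divff ?gt_eqF // -[X in X * _](gtr0_norm M0') -normrM.
by rewrite ltr_norml mulrBr; apply/andP; split; lra.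
Qed.

(** Were there finitely many solutions, they would stay at a distance [e] from
[xi], but the approximation with [q <= M] and [1 / M < e] is another one. *)
Lemma irrationality_exponent_ge2 xi : irrational xi ->
  (2%:E <= irrationality_exponent xi)%E.
Proof.
move=> irr; apply: ereal_sup_ubound; exists 2 => //= fin.
have [e e0 he] := finite_dist_gt0 irr fin.
pose M := (Num.bound e^-1).+1.
have M0 : 0 < M%:R :> R by rewrite ltr0n.
have eM : e^-1 < M%:R.
  apply: lt_le_trans (archi_boundP _) _; first by rewrite invr_ge0 ltW.
  by rewrite ler_nat.
have [p [q [q0 qM H]]] := dirichlet_approx xi (ltn0Sn (Num.bound e^-1)).
pose r : rat := p%:~R / q%:~R.
have q0' : 0 < q%:~R :> R by rewrite ltr0z.
have q1' : 1 <= q%:~R :> R by rewrite ler1z; lia.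
have rE : xi - ratr r = (q%:~R * xi - p%:~R) / q%:~R.
  rewrite /r fmorph_div !rmorph_int; field; exact: lt0r_neq0.
have dist : `|xi - ratr r| < M%:R^-1 / q%:~R.
  by rewrite rE normrM normfV (gtr0_norm q0') ltr_pM2r ?invr_gt0.
have : e <= `|xi - ratr r|.
  apply: he => /=; apply: (lt_le_trans dist).
  have d0 : 0 < (denq r)%:~R :> R by rewrite ltr0z denq_gt0.
  rewrite powR_mulrn ?(ltW d0) // div1r expr2 invfM.
  have dq : (denq r)%:~R <= q%:~R :> R by rewrite ler_int denq_le_frac.
  apply: ler_pM; rewrite ?invr_ge0 ?(ltW M0) ?(ltW q0') //.
    rewrite lef_pV2 ?posrE //; apply: le_trans dq _.
    by rewrite -[M%:R]/(M%:Z%:~R) ler_int.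
  by rewrite lef_pV2 ?posrE.
apply/negP; rewrite -ltNge; apply: lt_trans dist _.
apply: le_lt_trans (_ : M%:R^-1 < _).
  by rewrite ler_piMr ?invr_ge0 ?(ltW M0) ?invf_le1.
by rewrite -[ltRHS]invrK ltf_pV2 ?posrE ?invr_gt0.
Qed.

End Rational.

(** * Repetitions in the expansion *)

Section Expansion.
Context (R : realType) (b : nat) (hb : (1 < b)%N) (xi : R).

Let B : R := b%:R.
Let F n : int := Num.floor (B ^+ n * xi).
Let fr n : R := B ^+ n * xi - (F n)%:~R.

Let Bgt0 n : 0 < B ^+ n.
Proof. by rewrite exprn_gt0 // ltr0n (ltn_trans _ hb). Qed.

Let fr_ge0 n : 0 <= fr n. Proof. by rewrite subr_ge0 floor_le. Qed.

Let fr_lt1 n : fr n < 1.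
Proof. by have /andP[_] := floor_itv (B ^+ n * xi); rewrite intrD /fr ltrBlDl. Qed.

Let digit n : (bary_expansion hb xi n)%:R = B * fr n - fr n.+1.
Proof. exact: (bary_digitE hb (bary_expansionP hb xi) n). Qed.

Let fr_agree m i j : agree (bary_expansion hb xi) m i j ->
  B ^+ m * (fr i - fr j) = fr (i + m)%N - fr (j + m)%N.
Proof.
elim: m => [|m IH] H; first by rewrite mul1r !addn0.
rewrite exprS -mulrA IH; last by apply: agreeW H _.
have := digit (i + m); rewrite H // digit !addnS => E.
by rewrite mulrBr; lra.
Qed.

(** The rational number is the one whose expansion has the same first [j] digits
and is periodic from position [i] on with period [j - i]. *)
Lemma agree_approx i j : (i < j)%N ->
  exists r : rat, (denq r)%:~R <= B ^+ j /\
    forall m, agree (bary_expansion hb xi) m i j ->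
      B ^+ m * `|xi - ratr r| <= (denq r)%:~R^-1.
Proof.
move=> ij.
pose q : int := (b ^ j)%:Z - (b ^ i)%:Z.
have q0 : 0 < q by rewrite subr_gt0 ltz_nat ltn_exp2l.
have qR : q%:~R = B ^+ j - B ^+ i by rewrite rmorphB /= -!pmulrn !natrX.
pose r : rat := (F j - F i)%:~R / q%:~R.
have q0' : 0 < q%:~R :> R by rewrite ltr0z.
have dq : (denq r)%:~R <= q%:~R :> R by rewrite ler_int denq_le_frac.
have d0 : 0 < (denq r)%:~R :> R by rewrite ltr0z denq_gt0.
have rE : xi - ratr r = (fr j - fr i) / q%:~R.
  rewrite /r fmorph_div !rmorph_int /fr.
  have -> : B ^+ j * xi - (F j)%:~R - (B ^+ i * xi - (F i)%:~R) =
            q%:~R * xi - (F j - F i)%:~R by rewrite qR rmorphB /=; ring.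
  by field; exact: lt0r_neq0.
exists r; split.
  by apply: le_trans dq _; rewrite qR lerBlDr lerDl ltW.
move=> m H; rewrite rE normrM normfV (gtr0_norm q0') mulrA.
apply: (@le_trans _ _ (q%:~R^-1)); last by rewrite lef_pV2 ?posrE.
rewrite ler_piMl ?invr_ge0 ?(ltW q0') // -[X in X * _](gtr0_norm (Bgt0 m)) -normrM.
rewrite (fr_agree (agree_sym H)).
have := fr_ge0 (i + m); have := fr_lt1 (i + m).
have := fr_ge0 (j + m); have := fr_lt1 (j + m) => h1 h2 h3 h4.
by rewrite ler_norml; apply/andP; split; lra.
Qed.

End Expansion.

Lemma expr_gt_nat (R : realType) (b M m : nat) : (1 < b)%N -> (M <= m)%N ->
  M%:R < b%:R ^+ m :> R.
Proof.
move=> hb Mm; rewrite -natrX ltr_nat; apply: leq_ltn_trans Mm _.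
exact: ltn_expl.
Qed.

Lemma bary_nonperiodic (R : realType) (b : nat) (hb : (1 < b)%N) (xi : R) :
  irrational xi -> nonperiodic (bary_expansion hb xi).
Proof.
move=> irr i j ij; apply: contrapT => no.
have [r [_ hr]] := agree_approx hb xi ij.
have e0 := irrational_dist_gt0 r irr; set e := `|_| in e0 hr.
pose m := Num.bound e^-1.
have /hr : agree (bary_expansion hb xi) m i j.
  by apply: contrapT => K; apply: no; exists m.
apply/negP; rewrite -ltNge; apply: (@le_lt_trans _ _ 1).
  by rewrite invf_le1 ?ltr0z ?denq_gt0 // ler1z; have := denq_gt0 r; lia.
rewrite -ltr_pdivrMr // div1r; apply: lt_trans (expr_gt_nat R hb (leqnn m)).
by apply: archi_boundP; rewrite invr_ge0 ltW.
Qed.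

(** Only finitely many rational numbers approximate [xi] with exponent [1 + l].
The others give [b ^ m <= b ^ (j * l)]; the constant accounts for the finitely
many exceptions, which stay at a distance [e] from [xi]. *)
Lemma bary_sparse_repetitions (R : realType) (b : nat) (hb : (1 < b)%N)
    (xi l : R) : irrational xi -> 0 < l ->
  (irrationality_exponent xi < (1 + l)%:E)%E ->
  exists2 C : R, 0 <= C & sparse_repetitions (bary_expansion hb xi) l C.
Proof.
move=> irr l0 mul.
have fin : finite_set [set r : rat |
    `|xi - ratr r| < 1 / ((denq r)%:~R `^ (1 + l))].
  apply: contrapT => inf; move: mul; apply/negP; rewrite -leNgt.
  by apply: ereal_sup_ubound; exists (1 + l).
have [e e0 he] := finite_dist_gt0 irr fin.
have b1 : 1 <= b%:R :> R by rewrite ler1n ltnW.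
exists ((Num.bound e^-1)%:R / l); first by rewrite divr_ge0 ?ltW.
move=> i j m ij Hm; have [r [dB /(_ m Hm) rm]] := agree_approx hb xi ij.
have d0 : 0 < (denq r)%:~R :> R by rewrite ltr0z denq_gt0.
have d1 : 1 <= (denq r)%:~R :> R by rewrite ler1z; have := denq_gt0 r; lia.
have Bm0 : 0 < b%:R ^+ m :> R by rewrite exprn_gt0 // (lt_le_trans ltr01 b1).
rewrite mulrDr [l * (_ / l)]mulrC divfK ?gt_eqF // [l * _]mulrC.
have [rE|rnE] := pselect (`|xi - ratr r| < 1 / ((denq r)%:~R `^ (1 + l))).
  have em : b%:R ^+ m * e <= 1.
    apply: le_trans (_ : b%:R ^+ m * `|xi - ratr r| <= 1).
      by rewrite ler_pM2l // he.
    by apply: le_trans rm _; rewrite invf_le1.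
  have : (m <= Num.bound e^-1)%N.
    rewrite leqNgt; apply/negP => /ltnW/(expr_gt_nat R hb) h.
    move: em; apply/negP; rewrite -ltNge -ltr_pdivrMr // div1r.
    by apply: lt_trans h; apply: archi_boundP; rewrite invr_ge0 ltW.
  by rewrite -(ler_nat R) => h; have := mulr_ge0 (ltW l0) (ler0n R j); lra.
have {}rnE : b%:R ^+ m <= (denq r)%:~R `^ l.
  move/negP: rnE; rewrite -leNgt div1r => rnE.
  have := le_trans _ rm => /(_ (b%:R ^+ m * ((denq r)%:~R `^ (1 + l))^-1)).
  rewrite ler_pM2l // => /(_ rnE).
  rewrite ler_pdivrMr ?powR_gt0 // powRD; last by rewrite (gt_eqF d0) implybT.
  by rewrite powRr1 ?(ltW d0) // mulrA mulVf ?mul1r // gt_eqF.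
have {}rnE : b%:R `^ m%:R <= b%:R `^ (j%:R * l) :> R.
  rewrite powRrM !powR_mulrn ?ler0n //; apply: le_trans rnE _.
  apply: ge0_ler_powR; rewrite ?nnegrE ?(ltW l0) ?(ltW d0) //.
have lnb : 0 < ln (b%:R : R) by rewrite ln_gt0 // ltr1n.
have b0 : 0 < b%:R :> R by apply: lt_le_trans b1.
move: rnE; rewrite -ler_ln ?posrE ?powR_gt0 // !ln_powR ler_pM2r // => h.
have := ler0n R (Num.bound e^-1); lra.
Qed.

(** * Lower limits and comparison of the bounds *)

Lemma limn_einf_ge (R : realType) (u : nat -> R) (c : R) :
  (forall e, 0 < e -> exists N, forall n, (N <= n)%N -> c - e <= u n) ->
  (c%:E <= limn_einf (fun n => (u n)%:E))%E.
Proof.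
move=> H; apply/lee_subgt0Pr => e /H[N HN].
rewrite limn_einf_lim (cvg_lim _ (@cvg_einfs_sup _ _)) //.
apply: (@le_trans _ _ (einfs (fun n => (u n)%:E) N)); last first.
  by apply: ereal_sup_ubound; exists N.
by apply/ereal_infP => y [n /= Nn <-]; rewrite -EFinB lee_fin HN.
Qed.

Lemma limn_einf_ratio_ge (R : realType) (p : nat -> nat) (c : R) :
  (forall e, 0 < e -> exists K, forall n, (c - e) * n%:R <= (p n)%:R + K) ->
  (c%:E <= limn_einf (fun n => ((p n)%:R / n%:R)%:E))%E.
Proof.
move=> H; apply: limn_einf_ge => e e0.
have e2 : 0 < e / 2 by lra.
have [K HK] := H _ e2.
exists (Num.bound (`|K| / (e / 2))).+1 => n Nn.
have n0 : 0 < n%:R :> R by rewrite ltr0n (leq_trans _ Nn).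
rewrite ler_pdivlMr //.
have : `|K| <= e / 2 * n%:R.
  rewrite mulrC -ler_pdivrMr //; apply: ltW.
  apply: lt_le_trans (archi_boundP _) _; first by rewrite divr_ge0 // ltW.
  by rewrite ler_nat ltnW.
have := ler_norm K; have := HK n; lra.
Qed.

(** The arithmetic condition is available for every [l > mu - 1], so the bound at
[l = mu - 1] itself needs the continuity of the slope. *)
Lemma slope_lipschitz (R : realFieldType) (l d : R) : 1 <= l -> 0 <= d ->
  slope l - 2 * d <= slope (l + d).
Proof.
move=> l1 d0; rewrite /slope.
have p1 : 0 <= l * d by rewrite mulr_ge0; lra.
have p0 : 0 <= l * l by rewrite mulr_ge0; lra.
have h1 : l^-1 - (l + d)^-1 <= d.
  have -> : l^-1 - (l + d)^-1 = d / (l * (l + d)).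
    by field; apply/andP; split; lra.
  rewrite ler_pdivrMr; last by rewrite mulr_gt0; lra.
  by rewrite ler_peMr // -[leLHS]mulr1 ler_pM; lra.
have h2 : l / (1 + l) ^+ 2 - (l + d) / (1 + (l + d)) ^+ 2 <= d.
  have -> : l / (1 + l) ^+ 2 - (l + d) / (1 + (l + d)) ^+ 2 =
      d * ((l * (l + d) - 1) / ((1 + l) ^+ 2 * (1 + (l + d)) ^+ 2)).
    by field; apply/andP; split; lra.
  rewrite ler_piMr // ler_pdivrMr; last by rewrite mulr_gt0 ?exprn_gt0; lra.
  rewrite mul1r -exprMn.
  have : 1 * ((1 + l) * (1 + (l + d))) <= ((1 + l) * (1 + (l + d))) ^+ 2.
    by rewrite expr2 ler_pM //; lra.
  lra.
lra.
Qed.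

Lemma slope_quadratic (R : realFieldType) (m : R) : 2 <= m ->
  m ^+ 2 * ((m - 1) * slope (m - 1) ^+ 2 - slope (m - 1)) =
    (m - 1) ^+ 2 * slope (m - 1).
Proof. by move=> m2; rewrite /slope; field; apply/andP; split; lra. Qed.

(** With [l = m - 1], the excess of the bound over [1] has numerator
[1 + 2 * l - l ^ 2 - l ^ 3], which is at most the numerator [1 + l - l ^ 3] of
[slope l - 1], and its denominator is larger. *)
Lemma liminf_bound_le (R : realType) (m : R) : 2 <= m ->
  liminf_bound m%:E <= 1 \/
  (m - 1) ^+ 3 < m /\ liminf_bound m%:E <= slope (m - 1).
Proof.
move=> m2 /=; set l := m - 1; have l1 : 1 <= l by rewrite /l; lra.
have -> : m = l + 1 by rewrite /l; ring.
clearbody l; move: l1 => {m m2} l1.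
have l2 : 1 <= l ^+ 2 by exact: exprn_ege1.
have l3 : 1 <= l ^+ 3 by exact: exprn_ege1.
have l4 : 1 <= l ^+ 4 by exact: exprn_ege1.
set num := (X in X / _); set den := (X in _ / X).
have numE : num = 1 + 2 * l - l ^+ 2 - l ^+ 3 by rewrite /num; ring.
have denE : den = l ^+ 4 + 2 * l ^+ 3 + 3 * l ^+ 2 + l by rewrite /den; ring.
have den0 : 0 < den by lra.
have [num0|num0] := leP num 0; [left|right].
  by rewrite gerDl mulr_le0_ge0 // invr_ge0 ltW.
have l2' : l <= l ^+ 2 by rewrite expr2 ler_peMr; lra.
split; first by lra.
rewrite slopeE; last by lra.
have dl := @slope_den_gt0 _ l (lt_le_trans ltr01 l1).
rewrite -lerBrDl ler_pdivrMr // -subr_ge0.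
have -> : ((2 * l ^+ 2 + 2 * l + 1) / (l * (1 + l) ^+ 2) - 1) =
   (1 + l - l ^+ 3) / (l * (1 + l) ^+ 2).
  by field; apply/andP; split; lra.
rewrite subr_ge0 mulrAC ler_pdivlMr //.
apply: ler_pM; lra.
Qed.

(** [limsup_bound m%:E] is the larger root [c] of the quadratic equation
[m ^ 2 * ((m - 1) * c ^ 2 - c) = (m - 1) ^ 2]. *)
Lemma limsup_bound_le (R : realType) (m c : R) : 2 <= m -> 1 <= c ->
  (m - 1) ^+ 2 <= m ^+ 2 * ((m - 1) * c ^+ 2 - c) ->
  limsup_bound m%:E <= c.
Proof.
move=> m2 c1 H /=.
have d0 : 0 < 2 * m * (m - 1) by rewrite !mulr_gt0; lra.
rewrite ler_pdivrMr // -lerBrDl.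
have mc : 0 <= c * (2 * m * (m - 1)) - m.
  have -> : c * (2 * m * (m - 1)) - m = m * (2 * (c * (m - 1)) - 1) by ring.
  rewrite mulr_ge0 //; first by lra.
  have : 1 * 1 <= c * (m - 1) by rewrite ler_pM; lra.
  lra.
rewrite -[leRHS](ger0_norm mc) -sqrtr_sqr ler_wsqrtr //.
have h : 0 <= (m - 1) * (m ^+ 2 * ((m - 1) * c ^+ 2 - c) - (m - 1) ^+ 2).
  by rewrite mulr_ge0; lra.
lra.
Qed.

Lemma liminf_bound2 (R : realType) : liminf_bound (2%:E : \bar R) = 8 / 7.
Proof.
rewrite /=.
have -> : 2 ^+ 4 - 2 * 2 ^+ 3 + 3 * 2 ^+ 2 - 3 * 2 + 1 = 7 :> R by ring.
have -> : - 2 ^+ 3 + 2 * 2 ^+ 2 + 2 - 1 = 1 :> R by ring.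
lra.
Qed.

Lemma limsup_bound2 (R : realType) :
  limsup_bound (2%:E : \bar R) = (1 + Num.sqrt 2) / 2.
Proof.
rewrite /=.
have -> : 4 * (2 - 1) ^+ 3 + 2 ^+ 2 = 2 ^+ 2 * 2 :> R by ring.
have -> : 2 * 2 * (2 - 1) = 4 :> R by ring.
rewrite sqrtrM ?sqr_ge0 // sqrtr_sqr ger0_norm //; lra.
Qed.

(** * Lower limit of the complexity of a real number *)

Section Main.
Context (R : realType) (b : nat) (hb : (1 < b)%N) (xi : R) (irr : irrational xi).
Let ratio n : \bar R := ((bary_complexity hb xi n)%:R / n%:R)%:E.

Lemma bary_liminf_ge1 : (1%:E <= limn_einf ratio)%E.
Proof.
apply: limn_einf_ratio_ge => e e0; exists 0 => n.
have := complexity_geid (bary_nonperiodic hb irr) n.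
rewrite -(ler_nat R) -/(bary_complexity hb xi n) => h.
have := mulr_ge0 (ltW e0) (ler0n R n); lra.
Qed.

Lemma bary_liminf_ge_slope m : irrationality_exponent xi = m%:E -> 2 <= m ->
  (m - 1) ^+ 3 < m -> ((slope (m - 1))%:E <= limn_einf ratio)%E.
Proof.
move=> muE m2 m3; apply: limn_einf_ratio_ge => e e0.
set l := m - 1; have l1 : 1 <= l by rewrite /l; lra.
have mE : m = l + 1 by rewrite /l; ring.
rewrite -/l mE in m3; clearbody l.
pose D := 3 * l ^+ 2 + 3 * l + 1.
have D0 : 0 < D by rewrite /D; have := sqr_ge0 l; lra.
(* [D] bounds the increment of [l ^ 3] per unit step, the step being at most 1;
   with this [d] the condition on the cube survives the step. *)
pose d := Num.min 1 (Num.min (e / 2) ((l + 1 - l ^+ 3) / D)).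
have d0 : 0 < d by rewrite !lt_min ltr01 !divr_gt0 //; lra.
have [d1 de dD] : [/\ d <= 1, 2 * d <= e & d * D <= l + 1 - l ^+ 3].
  have : d <= d by []; rewrite {2}/d !le_min => /and3P[h1 h2 h3].
  by split=> //; [lra|rewrite -ler_pdivlMr].
have ld3 : (l + d) ^+ 3 <= (l + d) + 1.
  have h2 : d ^+ 2 <= d by rewrite expr2 ler_piMr // ltW.
  have h3 : d ^+ 3 <= d by rewrite exprS ler_piMr ?(ltW d0) // (le_trans h2).
  have h4 : l * d ^+ 2 <= l * d by rewrite ler_pM2l //; lra.
  rewrite /D in dD; lra.
have ld1 : 1 <= l + d by lra.
have [|C C0 sp] := @bary_sparse_repetitions R b hb xi (l + d) irr (lt_le_trans ltr01 ld1).
  by rewrite muE lte_fin; lra.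
exists (C + 3) => n.
have := complexity_linear (bary_nonperiodic hb irr) ld1 ld3 C0 sp n.
rewrite -/(bary_complexity hb xi n) => h.
have lip := slope_lipschitz l1 (ltW d0).
have n0 := ler0n R n.
have : (slope l - e) * n%:R <= slope (l + d) * n%:R by rewrite ler_wpM2r //; lra.
lra.
Qed.
End Main.

Theorem theorem1p4 (R : realType) (b : nat) (hb : (1 < b)%N) (xi : R)
    (hxi : irrational xi) :
  let mu := irrationality_exponent xi in
  let ratio := fun n : nat => ((bary_complexity hb xi n)%:R / n%:R : R)%:E in
  [/\ ((liminf_bound mu)%:E <= limn_einf ratio)%E,
      ((limsup_bound mu)%:E <= limn_esup ratio)%E &
      mu = (2 : R)%:E ->
        ((8 / 7 : R)%:E <= limn_einf ratio)%E /\
        (((1 + Num.sqrt 2) / 2 : R)%:E <= limn_esup ratio)%E].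
Proof.
move=> mu ratio.
have ge1 : (1%:E <= limn_einf ratio)%E := bary_liminf_ge1 hb hxi.
have infsup : (limn_einf ratio <= limn_esup ratio)%E := limn_einf_sup _.
have [inf sup] : ((liminf_bound mu)%:E <= limn_einf ratio)%E /\
    ((limsup_bound mu)%:E <= limn_esup ratio)%E.
  case muE : mu => [m||]; last 2 first.
  - by split=> //=; apply: le_trans (le_trans ge1 infsup); rewrite lee_fin.
  - by split=> //=; apply: le_trans (le_trans ge1 infsup); rewrite lee_fin.
  have m2 : 2 <= m.
    by have := irrationality_exponent_ge2 hxi; rewrite -/mu muE lee_fin.
  split.
    have [le1|[m3 lec]] := liminf_bound_le m2.
      by apply: le_trans ge1; rewrite lee_fin.
    by apply: le_trans (bary_liminf_ge_slope hb hxi muE m2 m3); rewrite lee_fin.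
  apply: le_trans infsup.
  have [m3|m3] := leP m ((m - 1) ^+ 3).
    apply: le_trans ge1; rewrite lee_fin limsup_bound_le //.
    by rewrite expr1n; lra.
  apply: le_trans (bary_liminf_ge_slope hb hxi muE m2 m3); rewrite lee_fin.
  have c1 : 1 <= slope (m - 1) by apply: slope_ge1; lra.
  apply: limsup_bound_le => //.
  have -> : m ^+ 2 * ((m - 1) * slope (m - 1) ^+ 2 - slope (m - 1)) =
      (m - 1) ^+ 2 * slope (m - 1).
    by apply: slope_quadratic.
  by rewrite ler_peMr // sqr_ge0.
split=> // mu2; rewrite mu2 liminf_bound2 limsup_bound2 in inf sup.
by split.
Qed.
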